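(* Let $n\ge 0$, let $\Pi=\{0,1,\dots,n\}$, and let $\mathcal{A}$ be a superset-closed adversary on $\Pi$. Then the formula $\Phi$ associated with $\mathcal{A}$ is not valid in $\mathcal{I}[\mathcal{R}_{\mathcal{A}}]$: there is a world $w$ of $\mathcal{I}[\mathcal{R}_{\mathcal{A}}]$ with $\mathcal{I}[\mathcal{R}_{\mathcal{A}}],w\not\models\Phi$.
   Context: Adversaries. A superset-closed adversary is a nonempty set $\mathcal{A}\subseteq 2^{\Pi}$ with $\emptyset\notin\mathcal{A}$ such that $P\in\mathcal{A}$ and $P\subseteq P'\subseteq\Pi$ imply $P'\in\mathcal{A}$. A survivor set is an inclusion-minimal element of $\mathcal{A}$. A core is an inclusion-minimal set $C\subseteq\Pi$ with $C\cap P\neq\emptyset$ for every $P\in\mathcal{A}$; $\mathit{csize}(\mathcal{A})$ is the minimum cardinality of a core. Epistemic logic. Atomic propositions are $\mathsf{input}_a^v$ for $a,v\in\Pi$. Formulas are built from these with $\vee,\wedge,\neg$ and modal operators $\mathrm{K}_a$ ($a\in\Pi$), $\mathrm{D}_A$ ($A\subseteq\Pi$). In a Kripke model with worlds $W$, equivalence relations $\sim_a$ ($a\in\Pi$) and labelling $L$ assigning to each world the set of true atomic propositions: $w\models p$ iff $p\in L(w)$ for atomic $p$; propositional connectives are as usual; $w\models\mathrm{K}_a\varphi$ iff $w'\models\varphi$ for all $w'$ with $w\sim_a w'$; $w\models\mathrm{D}_A\varphi$ iff $w'\models\varphi$ for all $w'$ such that $w\sim_a w'$ for every $a\in A$. $\mathsf{false}$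 is the constantly false formula, and empty disjunctions are $\mathsf{false}$. The model $\mathcal{I}[\mathcal{R}_{\mathcal{A}}]$ (one round of the round operator). Worlds are $X^{\vec S}$ where $X=\{(0,v_0),\dots,(n,v_n)\}$ with all $v_a\in\Pi$ (process $a$ has input $v_a$; write $\mathit{Input}_{X^{\vec S}}(a)=v_a$), and $\vec S=\langle S_0,\dots,S_n\rangle$ is a vector of subsets of $\Pi$ with: $S_a\in\mathcal{A}$ for every $a$; $a\in S_a$ for every $a$; and $S_a\subseteq S_{a'}$ or $S_a\supseteq S_{a'}$ for all $a,a'$. Write $\mathit{View}_{X^{\vec S}}(a)=S_a$. Labelling: $L(X^{\vec S})=\{\mathsf{input}_a^v\mid (a,v)\in X\}$. Relations: $X^{\vec S}\sim_a Y^{\vec S'}$ iff $S_a=S'_a$ and $\mathit{Input}_{X^{\vec S}}(a')=\mathit{Input}_{Y^{\vec S'}}(a')$ for every $a'\in S_a$. The formula $\Phi$. For $A\subseteq\Pi$, define by induction on $A$ with respect to reverse inclusion (starting from $A=\Pi$): $$\psi_A=\bigvee_{a\in\Pi\setminus A}\neg\mathsf{input}_a^a\ \vee\ \bigvee_{a\in\Pi\setminus A}\mathrm{K}_a\Bigl(\bigvee_{j\in A}\bigvee_{a'\in\Pi}\mathsf{input}_{a'}^j\Bigr)\ \vee\ \bigvee_{A\subsetneq B\subseteq\Pi}\Psi_B,$$ and $\Psi_A=\mathsf{false}$ if $\Pi\setminus A$ contains no survivor set as a subset, $\Psi_A=\mathrm{D}_A\psi_A$ otherwise. With $c=\mathit{csize}(\mathcal{A})$,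 $$\Phi=\bigvee_{a\in\Pi}\neg\mathsf{input}_a^a\ \vee\bigvee_{A\subseteq\Pi,\ 0<|A|<c}\Psi_A.$$ *)

(* Defs.v *)
From mathcomp Require Import all_boot.
From Stdlib Require Import RelationClasses.

Set Implicit Arguments.
Unset Strict Implicit.
Unset Printing Implicit Defensive.

Section Adversaries.
Variable T : finType.
Implicit Types (calA : {set {set T}}) (C P S : {set T}).

Definition superset_closed_adversary calA : Prop :=
  [/\ calA != set0, set0 \notin calA
    & forall P P', P \in calA -> P \subset P' -> P' \in calA].

Definition survivor_set calA S : bool := minset [pred P | P \in calA] S.

Definition hitting_set calA C : bool :=
  [forall P in calA, C :&: P != set0].

Definition core calA C : bool := minset [pred C' | hitting_set calA C'] C.

(* #|T| bounds every cardinality, so it is a neutral starting value for the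
   minimum; see csizeP. *)
Definition csize calA : nat := \big[minn/#|T|]_(C | core calA C) #|C|.

Lemma csizeP calA : superset_closed_adversary calA ->
  (exists2 C, core calA C & #|C| = csize calA) /\
  (forall C, core calA C -> csize calA <= #|C|).
Proof.
move=> [_ n0 _].
have hT : hitting_set calA setT.
  apply/forall_inP => P PA; rewrite setTI.
  by apply: contra n0 => /eqP <-.
have [C0 C0core _] := @minset_exists T [pred C' | hitting_set calA C'] setT hT.
have le C : core calA C -> csize calA <= #|C|.
  move=> cC; rewrite /csize; have := mem_index_enum C.
  elim: (index_enum _) => // D r IH; rewrite inE big_cons.
  case/predU1P => [<- | /IH le]; first by rewrite cC geq_minl.
  by case: ifP => // _; rewrite geq_min le orbT.
split=> //.
have : csize calA = #|T| \/ exists2 C, core calA C & #|C| = csize calA.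
  rewrite /csize; elim/big_ind: _ => [|x y|C cC]; [by left | | by right; exists C].
  rewrite /minn; case: ltnP => _ Hx Hy //.
case=> // eT; exists C0 => //; apply/eqP.
by rewrite eqn_leq le // eT max_card.
Qed.

End Adversaries.

Section EpistemicLogic.
Variable T : finType.

(* [Input a v] is the atom "process a has input v". *)
Inductive formula : Type :=
| Input of T & T
| FFalse
| FOr of formula & formula
| FAnd of formula & formula
| FNot of formula
| FK of T & formula
| FD of {set T} & formula.

Record kripke_model : Type := KripkeModel {
  km_world :> Type;
  km_rel : T -> km_world -> km_world -> Prop;
  km_relP : forall a, Equivalence (km_rel a);
  km_label : km_world -> {set T * T}
}.

Fixpoint sat (M : kripke_model) (w : M) (phi : formula) : Prop :=
  match phi with
  | Input a v => (a, v) \in km_label w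
  | FFalse => False
  | FOr phi1 phi2 => sat w phi1 \/ sat w phi2
  | FAnd phi1 phi2 => sat w phi1 /\ sat w phi2
  | FNot phi1 => ~ sat w phi1
  | FK a phi1 => forall w' : M, km_rel a w w' -> sat w' phi1
  | FD A phi1 =>
      forall w' : M, (forall a, a \in A -> km_rel a w w') -> sat w' phi1
  end.

End EpistemicLogic.

Arguments FFalse {T}.

Notation "\FOr_ ( i 'in' A ) F" := (\big[@FOr _/FFalse]_(i in A) F)
  (at level 41, F at level 41, i, A at level 50).
Notation "\FOr_ ( i | P ) F" := (\big[@FOr _/FFalse]_(i | P%B) F)
  (at level 41, F at level 41, i at level 50).
Notation "\FOr_ ( i : t | P ) F" := (\big[@FOr _/FFalse]_(i : t | P%B) F)
  (at level 41, F at level 41, only parsing).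

Section OneRound.
Variables (T : finType) (calA : {set {set T}}).

(* The world X^S: [w_input] is the graph function of X, [w_view] is S. *)
Record world : Type := World {
  w_input : {ffun T -> T};
  w_view : {ffun T -> {set T}};
  w_view_adv : forall a, w_view a \in calA;
  w_view_self : forall a, a \in w_view a;
  w_view_chain : forall a a',
    (w_view a \subset w_view a') || (w_view a' \subset w_view a)
}.

Definition indist (a : T) (w w' : world) : Prop :=
  w_view w a = w_view w' a /\
  forall a', a' \in w_view w a -> w_input w a' = w_input w' a'.

Lemma indist_equivalence a : Equivalence (indist a).
Proof.
split=> [w|w w' [e h]|w w' w'' [e h] [e' h']]; split=> //.
- by move=> b; rewrite -e => /h.
- by rewrite e.
- by move=> b bw; rewrite h // h' // -e.
Qed.

(* The model I[R_A]. *)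
Definition one_round_model : kripke_model T :=
  KripkeModel indist_equivalence
    (fun w => [set p : T * T | w_input w p.1 == p.2]).

Definition contains_survivor (Q : {set T}) : bool :=
  [exists S : {set T}, survivor_set calA S && (S \subset Q)].

(* psi_A, with the formulas Psi_B for larger B supplied by the argument F. *)
Definition psi_step (F : {set T} -> formula T) (A : {set T}) : formula T :=
  FOr (\FOr_(a in ~: A) FNot (Input a a))
  (FOr (\FOr_(a in ~: A) FK a (\FOr_(j in A) \FOr_(a' in T) Input a' j))
       (\FOr_(B : {set T} | A \proper B) F B)).

(* The induction on reverse inclusion is carried out by recursion on a bound
   on #|~: A|; PsiE gives the defining equation, free of the bound. *)
Fixpoint Psi_rec (k : nat) (A : {set T}) : formula T :=
  if k is k'.+1 then
    if contains_survivor (~: A) then FD A (psi_step (Psi_rec k') A) else FFalse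
  else FFalse.

Definition Psi (A : {set T}) : formula T := Psi_rec #|~: A|.+1 A.

Definition psi (A : {set T}) : formula T := psi_step Psi A.

Lemma Psi_rec_stable k l A :
  #|~: A| < k -> #|~: A| < l -> Psi_rec k A = Psi_rec l A.
Proof.
elim: k l A => [|k IH] [|l] A //= hk hl.
case: ifP => // _; congr (FD A (FOr _ (FOr _ _))).
apply: eq_bigr => B AB.
have lt : #|~: B| < #|~: A| by apply: proper_card; rewrite properC.
by apply: IH; [exact: leq_trans lt hk | exact: leq_trans lt hl].
Qed.

Lemma PsiE A :
  Psi A = if contains_survivor (~: A) then FD A (psi A) else FFalse.
Proof.
rewrite {1}/Psi /=; case: ifP => // _; congr (FD A (FOr _ (FOr _ _))).
apply: eq_bigr => B AB; apply: Psi_rec_stable => //.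
by apply: proper_card; rewrite properC.
Qed.

Definition Phi : formula T :=
  FOr (\FOr_(a in T) FNot (Input a a))
      (\FOr_(A : {set T} | 0 < #|A| < csize calA) Psi A).

End OneRound.

(* Main.v *)
(* Let every process have its own name as input. Starting from the world where
   everybody sees everybody, falsify Psi_B by moving to the world where the
   processes outside B see exactly ~: B while those in B keep their views.
   Inputs outside the view ~: B can then be changed to avoid B, so no process
   outside B knows that some input lies in B; for larger sets the move is
   iterated. *)
Require Import Defs.
From mathcomp Require Import all_boot.

Set Implicit Arguments.
Unset Strict Implicit.
Unset Printing Implicit Defensive.

Section NotValid.
Variables (T : finType) (calA : {set {set T}}).
Hypothesis hA : superset_closed_adversary calA.
Implicit Types (A B Q : {set T}) (w : one_round_model calA).

Lemma sat_bigFOr (M : kripke_model T) (w : M) (I : finType) (P : pred I)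
    (F : I -> formula T) :
  sat w (\big[@FOr _/FFalse]_(i | P i) F i) -> exists2 i, P i & sat w (F i).
Proof. by elim/big_rec: _ => //= i phi Pi IH [Fi|/IH //]; exists i. Qed.

Lemma contains_survivor_adv Q : contains_survivor calA Q -> Q \in calA.
Proof.
case: hA => _ _ up /existsP [S /andP [/minsetP [/= SA _] SQ]].
exact: up SA SQ.
Qed.

(** The lower bound [~: A] on every view, including those inside [A], is what keeps views comparable
    when the move is repeated for a larger set. *)
Definition isolated A w : Prop :=
  [/\ forall a, w_input w a = a,
      forall a, ~: A \subset w_view w a
    & forall a, a \notin A -> w_view w a = ~: A].

Lemma isolated_step A B w :
    isolated A w -> A \subset B -> ~: B \in calA ->
  exists2 w' : one_round_model calA,
    isolated B w' & forall b, b \in B -> indist b w w'.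
Proof.
move=> [inpw subw _] AB BA.
pose v := [ffun a => if a \in B then w_view w a else ~: B].
(* The new view [~: B] lies below all others, so comparability is only at stake between two old
   views. *)
have sub a : ~: B \subset v a.
  rewrite ffunE; case: ifP => // _.
  by apply: subset_trans (subw a); rewrite setCS.
have adv a : v a \in calA.
  by rewrite ffunE; case: ifP => // _; apply: w_view_adv.
have self a : a \in v a.
  by rewrite ffunE; case: ifP => [_|aB]; rewrite ?w_view_self // inE aB.
have chain a a' : (v a \subset v a') || (v a' \subset v a).
  have [aB|aB] := boolP (a \in B); last first.
    by rewrite [v a]ffunE (negPf aB) sub.
  have [a'B|a'B] := boolP (a' \in B); last first.
    by rewrite [v a']ffunE (negPf a'B) sub orbT.
  by rewrite !ffunE aB a'B w_view_chain.
exists (World (w_input w) adv self chain).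
  by split=> //= a aB; rewrite ffunE (negPf aB).
by move=> b bB; split=> //=; rewrite ffunE bB.
Qed.

Lemma isolated_ignorant A w a : isolated A w -> a \notin A ->
  ~ sat w (FK a (\FOr_(j in A) \FOr_(a' in T) Input a' j)).
Proof.
move=> [inpw _ vieww] aA /= Ka.
(* Any value outside [A] would do for the hidden inputs; [a] is one at hand. *)
pose w' := @World _ calA [ffun x => if x \in A then a else x] (w_view w)
  (w_view_adv w) (w_view_self w) (w_view_chain w).
have ww' : indist a w w'.
  split=> //= b; rewrite vieww // inE => bA.
  by rewrite ffunE (negPf bA) inpw.
have /sat_bigFOr [j jA /sat_bigFOr [b _]] := Ka w' ww'.
rewrite /= inE /= ffunE => /eqP bj.
by move: bj jA; case: ifPn => bA <-; apply/negP.
Qed.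

(** Induction on [#|~: A|], for all worlds at once because the refuting world changes: at [w'],
    isolated for [B], the first two kinds of disjunct of [psi] fail directly, and each [Psi] of a
    larger [C] falls to the induction hypothesis. *)
Lemma isolated_not_Psi A B w :
  isolated A w -> A \proper B -> ~ sat w (Psi calA B).
Proof.
have [k] := ubnP #|~: A|; elim: k A B w => // k IH A B w cA iw AB.
rewrite PsiE; case: ifP => [/contains_survivor_adv BA Dw|_ []].
have [w' iw' ww'] := isolated_step iw (proper_sub AB) BA.
have cB : #|~: B| < k.
  by apply: leq_trans (cA : _ <= k); apply: proper_card; rewrite properC.
case: (Dw w' ww') => [/sat_bigFOr [a _ /=]|[|]].
- by case: iw' => inpw' _ _; rewrite inE /= inpw' eqxx; apply.
- move=> /sat_bigFOr [a]; rewrite inE; exact: isolated_ignorant.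
- by move=> /sat_bigFOr [C BC]; apply: IH iw' BC.
Qed.

Lemma exists_isolated0 : exists w, isolated set0 w.
Proof.
case: hA => /set0Pn [P PA] _ up.
have adv a : [ffun _ : T => [set: T]] a \in calA.
  by rewrite ffunE; apply: up PA (subsetT P).
have self a : a \in [ffun _ : T => [set: T]] a by rewrite ffunE inE.
have chain a a' : ([ffun _ : T => [set: T]] a \subset [ffun=> setT] a')
    || ([ffun _ : T => [set: T]] a' \subset [ffun=> setT] a).
  by rewrite !ffunE subxx.
exists (World [ffun a => a] adv self chain).
by split=> a /=; rewrite ffunE ?setC0.
Qed.

Lemma Phi_not_valid : exists w, ~ sat w (Phi calA).
Proof.
have [w iw] := exists_isolated0; exists w => -[] /sat_bigFOr [].
  by move=> a _ /=; case: iw => inpw _ _; rewrite inE /= inpw eqxx; apply.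
(* Positive cardinality makes [A] a proper superset of [set0], where the descent starts. *)
move=> A /andP [A0 _]; apply: isolated_not_Psi iw _.
by rewrite proper0 -card_gt0.
Qed.

End NotValid.

Theorem proposition4p3 (n : nat) (calA : {set {set 'I_n.+1}})
    (hA : superset_closed_adversary calA) :
  exists w : one_round_model calA, ~ sat w (Phi calA).
Proof. exact: Phi_not_valid. Qed.
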